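(* Let $(\alpha,\beta)\in\mathbb{C}^2$ satisfy \[\left(\frac{|\alpha|^4+4|\alpha\beta|^2+|\beta|^4}{6}\right)^{\frac14}\leq \frac{2}{\pi}.\] Then there is a harmonic function $f\colon\mathbb{D}\to\mathbb{D}$ with $f(0)=0$, $\partial f(0)=\alpha$ and $\overline{\partial} f(0)=\beta$.
   Context: $\mathbb{D}=\{z\in\mathbb{C}:|z|<1\}$ is the open unit disc. A harmonic function $f\colon\mathbb{D}\to\mathbb{D}$ is a complex-valued function satisfying Laplace's equation (equivalently, its real and imaginary parts are harmonic), with values in $\mathbb{D}$. The Wirtinger derivatives are $\partial=\frac12\left(\frac{\partial}{\partial x}-i\frac{\partial}{\partial y}\right)$ and $\overline{\partial}=\frac12\left(\frac{\partial}{\partial x}+i\frac{\partial}{\partial y}\right)$, where $z=x+iy$. *)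

(* Defs.v *)
(* Stdlib world: concrete reals, with Coquelicot's complex numbers C = R * R. *)
From Stdlib Require Export Reals.
From Coquelicot Require Export Coquelicot.
Open Scope R_scope.

Definition in_disc (z : C) : Prop := Cmod z < 1.

Definition re_part (f : C -> C) (x y : R) : R := Re (f (x, y)).
Definition im_part (f : C -> C) (x y : R) : R := Im (f (x, y)).

(* Partial derivatives of a complex-valued function of z = x + i y, taken
   componentwise. [Derive] is total, so they are meaningful only where f is
   differentiable; [harmonic_on] below requires this. *)
Definition partial_x (f : C -> C) (z : C) : C :=
  (Derive (fun t => re_part f t (Im z)) (Re z),
   Derive (fun t => im_part f t (Im z)) (Re z)).

Definition partial_y (f : C -> C) (z : C) : C :=
  (Derive (fun t => re_part f (Re z) t) (Im z),
   Derive (fun t => im_part f (Re z) t) (Im z)).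

Definition wirtinger (f : C -> C) (z : C) : C :=
  ((partial_x f z - Ci * partial_y f z) / 2)%C.

Definition wirtinger_bar (f : C -> C) (z : C) : C :=
  ((partial_x f z + Ci * partial_y f z) / 2)%C.

Definition laplacian (f : C -> C) (z : C) : C :=
  (partial_x (partial_x f) z + partial_y (partial_y f) z)%C.

(* [ex_diff_n u 2 x y] asks that u and all its partial derivatives of order at
   most 2 exist and be continuous at (x, y); required at every point of an open
   set D, it says that u is of class C^2 on D. D is meant to be open. *)
Definition C2_on (D : C -> Prop) (f : C -> C) : Prop :=
  forall z : C, D z ->
    ex_diff_n (re_part f) 2 (Re z) (Im z) /\
    ex_diff_n (im_part f) 2 (Re z) (Im z).

Definition harmonic_on (D : C -> Prop) (f : C -> C) : Prop :=
  C2_on D f /\ forall z : C, D z -> laplacian f z = 0%C.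

(* Defined by square roots because Rpower 0 (1/4) = 1 in the library. *)
Definition fourth_root (x : R) : R := sqrt (sqrt x).

(* Main.v *)
(* After a rotation in the source and one in the target, |alpha| = (2/pi) (s + t) and
   |beta| = (2/pi) (s - t) with s >= |t|, and the hypothesis reads
   3 s^4 + 2 s^2 t^2 + 3 t^4 <= 3. A harmonic map of the disc whose boundary values
   are a step function with values x_j + i y_j in the closed disc on arcs of the first
   quadrant, extended by f (conj z) = conj (f z) and f (- z) = - f z, is a combination
   of the functions atan (2 Re (conj zeta z) / (1 - |z|^2)) with zeta = p_j + i q_j or
   zeta = p_j - i q_j, where q_j + i p_j are the end points of the arcs, and realizes
   s = sum x_j (p_(j+1) - p_j), t = sum y_j (q_j - q_(j+1)).
   With seven arcs having rational end points, the region of pairs (s, t) so realized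
   contains that of the hypothesis: near the corner (1, 0), where both boundaries
   touch, by an explicit one-parameter family of steps, and elsewhere because a polygon
   with realized vertices contains it. *)
Require Import Defs.
From Stdlib Require Import Reals Lra Lia List.
From Coquelicot Require Import Coquelicot.
Import ListNotations.
Open Scope R_scope.

(** * Harmonic functions with prescribed Wirtinger derivatives at the origin *)

(** The partial derivatives are explicit witnesses rather than values of the total [Derive], so
    linear combinations are formed termwise. Both mixed ones are carried because [ex_diff_n] asks
    for them. *)
Definition harmonic_jet (h : R -> R -> R) (hx hy : R) : Prop :=
  exists h1 h2 h11 h12 h21 h22 : R -> R -> R,
    (forall x y, x ^ 2 + y ^ 2 < 1 ->
      is_derive (fun t => h t y) x (h1 x y) /\
      is_derive (fun t => h x t) y (h2 x y) /\
      is_derive (fun t => h1 t y) x (h11 x y) /\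
      is_derive (fun t => h1 x t) y (h12 x y) /\
      is_derive (fun t => h2 t y) x (h21 x y) /\
      is_derive (fun t => h2 x t) y (h22 x y) /\
      continuity_2d_pt h x y /\
      continuity_2d_pt h1 x y /\ continuity_2d_pt h2 x y /\
      continuity_2d_pt h11 x y /\ continuity_2d_pt h12 x y /\
      continuity_2d_pt h21 x y /\ continuity_2d_pt h22 x y /\
      h11 x y + h22 x y = 0) /\
    h1 0 0 = hx /\ h2 0 0 = hy.

Ltac continuity_2d :=
  repeat first
    [ apply continuity_2d_pt_const
    | apply continuity_2d_pt_id1
    | apply continuity_2d_pt_id2
    | assumption
    | apply continuity_2d_pt_plus
    | apply continuity_2d_pt_minus
    | apply continuity_2d_pt_opp
    | apply continuity_2d_pt_mult
    | apply continuity_2d_pt_inv ].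

(* [repeat split] would also unfold [is_derive], which is a conjunction. *)
Ltac split_conj := repeat match goal with |- _ /\ _ => split end.

Lemma harmonic_jet_lin (a b : R) (g h : R -> R -> R) (gx gy hx hy : R) :
  harmonic_jet g gx gy -> harmonic_jet h hx hy ->
  harmonic_jet (fun x y => a * g x y + b * h x y) (a * gx + b * hx) (a * gy + b * hy).
Proof.
intros (g1 & g2 & g11 & g12 & g21 & g22 & Hg & Hgx & Hgy)
       (h1 & h2 & h11 & h12 & h21 & h22 & Hh & Hhx & Hhy).
exists (fun x y => a * g1 x y + b * h1 x y), (fun x y => a * g2 x y + b * h2 x y),
  (fun x y => a * g11 x y + b * h11 x y), (fun x y => a * g12 x y + b * h12 x y),
  (fun x y => a * g21 x y + b * h21 x y), (fun x y => a * g22 x y + b * h22 x y).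
split; [|split; congruence].
intros x y Hxy.
destruct (Hg x y Hxy) as (G1 & G2 & G3 & G4 & G5 & G6 & G7 & G8 & G9 & G10 & G11 & G12 & G13 & G14).
destruct (Hh x y Hxy) as (H1 & H2 & H3 & H4 & H5 & H6 & H7 & H8 & H9 & H10 & H11 & H12 & H13 & H14).
assert (D : forall u v l m z, is_derive u z l -> is_derive v z m ->
  is_derive (fun t => a * u t + b * v t) z (a * l + b * m)).
{ intros u v l m z Hu Hv.
  apply (is_derive_plus (K := R_AbsRing) (V := R_NormedModule)
           (fun t => a * u t) (fun t => b * v t)); now apply is_derive_scal. }
split_conj; try (apply D; assumption); try continuity_2d.
transitivity (a * (g11 x y + g22 x y) + b * (h11 x y + h22 x y)); [ring|].
rewrite G14, H14; ring.
Qed.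

Lemma harmonic_jet_zero : harmonic_jet (fun _ _ => 0) 0 0.
Proof.
exists (fun _ _ => 0), (fun _ _ => 0), (fun _ _ => 0), (fun _ _ => 0), (fun _ _ => 0), (fun _ _ => 0).
split; [|now split].
intros x y _.
split_conj; try exact (is_derive_const (V := R_NormedModule) 0 _); try continuity_2d; ring.
Qed.

Lemma harmonic_jet_ext (g h : R -> R -> R) (gx gy hx hy : R) :
  (forall x y, g x y = h x y) -> gx = hx -> gy = hy ->
  harmonic_jet g gx gy -> harmonic_jet h hx hy.
Proof.
intros E <- <- (g1 & g2 & g11 & g12 & g21 & g22 & Hg & Hgx & Hgy).
exists g1, g2, g11, g12, g21, g22.
split; [|now split].
intros x y Hxy.
destruct (Hg x y Hxy) as (G1 & G2 & G3 & G4 & G5 & G6 & G7 & G8).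
split_conj; try tauto.
- now apply is_derive_ext with (fun t => g t y).
- now apply is_derive_ext with (fun t => g x t).
- now apply continuity_2d_pt_ext with g.
Qed.

Lemma locally_2d_disc (x y : R) :
  x ^ 2 + y ^ 2 < 1 -> locally_2d (fun u v => u ^ 2 + v ^ 2 < 1) x y.
Proof.
intros H.
assert (C : continuity_2d_pt (fun u v => u * u + v * v) x y) by continuity_2d.
assert (He : 0 < 1 - (x ^ 2 + y ^ 2)) by lra.
destruct (C (mkposreal _ He)) as [d Hd].
exists d; intros u v Hu Hv.
specialize (Hd u v Hu Hv); simpl in Hd.
apply Rabs_def2 in Hd; nra.
Qed.

(* The Poisson extension of the sign of [P x + Q y] on the unit circle is
   [2 / PI] times this function. *)
Definition arc_potential (P Q x y : R) : R :=
  atan (2 * (P * x + Q * y) / (1 - x ^ 2 - y ^ 2)).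

(** With zeta = P + i Q and w = conj zeta z, the potential is the argument of (1 + i w) / (1 - i w),
    hence harmonic. *)
Lemma arc_potential_jet (P Q : R) :
  P ^ 2 + Q ^ 2 = 1 -> harmonic_jet (arc_potential P Q) (2 * P) (2 * Q).
Proof.
intros PQ.
(* The potential is atan (N / D). Here ([U1], [U2]) = D grad N - N grad D and ([E1], [E2]) = grad E,
   so its gradient is ([U1], [U2]) / [E]. *)
pose (N := fun x y => 2 * (P * x + Q * y)).
pose (D := fun x y => 1 - x * x - y * y).
pose (E := fun x y => D x y * D x y + N x y * N x y).
pose (U1 := fun x y => 2 * P * D x y + 2 * x * N x y).
pose (U2 := fun x y => 2 * Q * D x y + 2 * y * N x y).
pose (E1 := fun x y => - (4 * x * D x y) + 4 * P * N x y).
pose (E2 := fun x y => - (4 * y * D x y) + 4 * Q * N x y).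
exists (fun x y => U1 x y * / E x y), (fun x y => U2 x y * / E x y),
  (fun x y => (2 * N x y * E x y - U1 x y * E1 x y) * / (E x y * E x y)),
  (fun x y => ((4 * x * Q - 4 * P * y) * E x y - U1 x y * E2 x y) * / (E x y * E x y)),
  (fun x y => ((4 * y * P - 4 * Q * x) * E x y - U2 x y * E1 x y) * / (E x y * E x y)),
  (fun x y => (2 * N x y * E x y - U2 x y * E2 x y) * / (E x y * E x y)).
split; [|unfold U1, U2, E, D, N; split; field].
intros x y Hxy.
assert (HD : 0 < D x y) by (unfold D; nra).
assert (HE : 0 < E x y) by (unfold E; nra).
assert (HD' : D x y <> 0) by lra.
assert (HE' : E x y <> 0) by lra.
assert (HEE : E x y * E x y <> 0) by now apply Rmult_integral_contrapositive_currified.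
assert (HA : 1 + (N x y * / D x y) * (N x y * / D x y) <> 0) by nra.
assert (cN : continuity_2d_pt N x y) by (unfold N; continuity_2d).
assert (cD : continuity_2d_pt D x y) by (unfold D; continuity_2d).
assert (cE : continuity_2d_pt E x y) by (unfold E; continuity_2d).
assert (cU1 : continuity_2d_pt U1 x y) by (unfold U1; continuity_2d).
assert (cU2 : continuity_2d_pt U2 x y) by (unfold U2; continuity_2d).
assert (cE1 : continuity_2d_pt E1 x y) by (unfold E1; continuity_2d).
assert (cE2 : continuity_2d_pt E2 x y) by (unfold E2; continuity_2d).
split_conj; try (continuity_2d; assumption).
- unfold arc_potential; auto_derive; [unfold D in HD'; contradict HD'; lra |].
  unfold U1, E, N, D in *; field.
  split; nra.
- unfold arc_potential; auto_derive; [unfold D in HD'; contradict HD'; lra |].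
  unfold U2, E, N, D in *; field.
  split; nra.
- unfold U1, U2, E1, E2, E, N, D in *; auto_derive; [assumption | field; nra].
- unfold U1, U2, E1, E2, E, N, D in *; auto_derive; [assumption | field; nra].
- unfold U1, U2, E1, E2, E, N, D in *; auto_derive; [assumption | field; nra].
- unfold U1, U2, E1, E2, E, N, D in *; auto_derive; [assumption | field; nra].
- apply continuity_2d_pt_ext with (fun u v => atan (N u v * / (1 - u ^ 2 - v ^ 2))).
  { reflexivity. }
  apply (continuity_1d_2d_pt_comp atan).
  { apply continuity_pt_filterlim, continuous_atan. }
  apply continuity_2d_pt_mult; [assumption|].
  apply continuity_2d_pt_inv; [|unfold D in HD'; contradict HD'; lra].
  apply continuity_2d_pt_ext with D; [intros; unfold D; ring | assumption].
(* The divergence of ([U1], [U2]) is 4 N, so the Laplacian vanishes once 4 N E equals the product of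
   ([U1], [U2]) with grad E; their difference has the factor P^2 + Q^2 - 1. *)
- transitivity ((4 * N x y * E x y - (U1 x y * E1 x y + U2 x y * E2 x y)) * / (E x y * E x y)).
  { ring. }
  replace (U1 x y * E1 x y + U2 x y * E2 x y) with (4 * N x y * E x y); [ring|].
  unfold U1, U2, E1, E2, E, N, D.
  match goal with |- ?l = ?r =>
    cut (r - l = 16 * (P * x + Q * y) * (1 - x * x - y * y) * (P ^ 2 + Q ^ 2 - 1)) end.
  { rewrite PQ; lra. }
  ring.
Qed.

(** For f = u + i v, the numbers [a] and [b] are the two Wirtinger derivatives at the origin,
    expressed by the gradients of u and v. *)
Definition harmonic_with (f : C -> C) (a b : C) : Prop :=
  f 0%C = 0%C /\
  exists ux uy vx vy,
    harmonic_jet (re_part f) ux uy /\ harmonic_jet (im_part f) vx vy /\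
    a = ((ux + vy) / 2, (vx - uy) / 2) /\ b = ((ux - vy) / 2, (vx + uy) / 2).

(** Second derivatives depend on first ones near the point, so openness of the disc is what lets
    [h1] and [h2] replace the nested [Derive]. *)
Lemma harmonic_jet_correct (h : R -> R -> R) (hx hy : R) :
  harmonic_jet h hx hy ->
  (forall x y, x ^ 2 + y ^ 2 < 1 ->
    ex_diff_n h 2 x y /\
    Derive (fun t => Derive (fun s => h s y) t) x +
    Derive (fun t => Derive (fun s => h x s) t) y = 0) /\
  Derive (fun t => h t 0) 0 = hx /\ Derive (fun t => h 0 t) 0 = hy.
Proof.
intros (h1 & h2 & h11 & h12 & h21 & h22 & H & Hx & Hy).
assert (D1 : forall x y, x ^ 2 + y ^ 2 < 1 -> Derive (fun t => h t y) x = h1 x y).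
{ intros x y Hxy; apply is_derive_unique; now apply H. }
assert (D2 : forall x y, x ^ 2 + y ^ 2 < 1 -> Derive (fun t => h x t) y = h2 x y).
{ intros x y Hxy; apply is_derive_unique; now apply H. }
split; [|split; [rewrite <- Hx; apply D1; lra | rewrite <- Hy; apply D2; lra]].
intros x y Hxy.
destruct (H x y Hxy) as (H1 & H2 & H3 & H4 & H5 & H6 & H7 & H8 & H9 & H10 & H11 & H12 & H13 & H14).
pose proof (locally_2d_disc x y Hxy) as L.
assert (S : forall k k1 k2 : R -> R -> R,
  locally_2d (fun u v => is_derive (fun t => k t v) u (k1 u v)) x y ->
  locally_2d (fun u v => is_derive (fun t => k u t) v (k2 u v)) x y ->
  continuity_2d_pt k x y -> continuity_2d_pt k1 x y -> continuity_2d_pt k2 x y ->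
  ex_diff_n k 1 x y).
{ intros k k1 k2 L1 L2 C0 C1 C2.
  split; [assumption|split; [|split; [|split; (split; [|exact I])]]].
  - exists (k1 x y); exact (locally_2d_singleton _ _ _ L1).
  - exists (k2 x y); exact (locally_2d_singleton _ _ _ L2).
  - apply continuity_2d_pt_ext_loc with k1; [|assumption].
    revert L1; apply locally_2d_impl, locally_2d_forall.
    intros u v Hd; symmetry; now apply is_derive_unique.
  - apply continuity_2d_pt_ext_loc with k2; [|assumption].
    revert L2; apply locally_2d_impl, locally_2d_forall.
    intros u v Hd; symmetry; now apply is_derive_unique. }
split.
- split; [assumption|split; [now exists (h1 x y)|split; [now exists (h2 x y)|split]]].
  + apply ex_diff_n_ext_loc with h1.
    { revert L; apply locally_2d_impl, locally_2d_forall; intros; symmetry; now apply D1. }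
    apply S with h11 h12; try assumption;
      (revert L; apply locally_2d_impl, locally_2d_forall; intros; now apply H).
  + apply ex_diff_n_ext_loc with h2.
    { revert L; apply locally_2d_impl, locally_2d_forall; intros; symmetry; now apply D2. }
    apply S with h21 h22; try assumption;
      (revert L; apply locally_2d_impl, locally_2d_forall; intros; now apply H).
- rewrite <- H14; f_equal.
  + rewrite (Derive_ext_loc _ (fun t => h1 t y)); [now apply is_derive_unique|].
    apply locally_2d_1d_const_y in L; revert L; apply filter_imp.
    intros t Ht; now apply D1.
  + rewrite (Derive_ext_loc _ (fun t => h2 x t)); [now apply is_derive_unique|].
    apply locally_2d_1d_const_x in L; revert L; apply filter_imp.
    intros t Ht; now apply D2.
Qed.

Lemma in_disc_sqr (x y : R) : in_disc (x, y) <-> x ^ 2 + y ^ 2 < 1.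
Proof.
unfold in_disc, Cmod; simpl fst; simpl snd.
split; intros H.
- destruct (Rlt_le_dec (x ^ 2 + y ^ 2) 1) as [|K]; [assumption|].
  apply sqrt_le_1_alt in K; rewrite sqrt_1 in K; lra.
- rewrite <- sqrt_1; apply sqrt_lt_1_alt; nra.
Qed.

Lemma harmonic_with_correct (f : C -> C) (a b : C) :
  harmonic_with f a b ->
  harmonic_on in_disc f /\ f 0%C = 0%C /\ wirtinger f 0%C = a /\ wirtinger_bar f 0%C = b.
Proof.
intros (H0 & ux & uy & vx & vy & Hu & Hv & -> & ->).
apply harmonic_jet_correct in Hu; apply harmonic_jet_correct in Hv.
destruct Hu as (Hu & Ux & Uy); destruct Hv as (Hv & Vx & Vy).
split; [split|split; [assumption|]].
- intros [x y] Hz; apply in_disc_sqr in Hz.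
  split; [now apply Hu | now apply Hv].
- intros [x y] Hz; apply in_disc_sqr in Hz.
  apply injective_projections; [apply (Hu x y Hz) | apply (Hv x y Hz)].
- unfold wirtinger, wirtinger_bar, partial_x, partial_y.
  cbn [Re Im fst snd RtoC].
  rewrite Ux, Uy, Vx, Vy.
  split; apply injective_projections; cbn; field.
Qed.

Lemma harmonic_with_plus (f g : C -> C) (a b a' b' : C) :
  harmonic_with f a b -> harmonic_with g a' b' ->
  harmonic_with (fun z => (f z + g z)%C) (a + a')%C (b + b')%C.
Proof.
intros (Hf & ux & uy & vx & vy & Hu & Hv & -> & ->)
       (Hg & ux' & uy' & vx' & vy' & Hu' & Hv' & -> & ->).
split; [rewrite Hf, Hg; ring|].
exists (1 * ux + 1 * ux'), (1 * uy + 1 * uy'), (1 * vx + 1 * vx'), (1 * vy + 1 * vy').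
split; [|split; [|split]].
- eapply harmonic_jet_ext; [| | | exact (harmonic_jet_lin 1 1 _ _ _ _ _ _ Hu Hu')]; try reflexivity.
  intros x y; unfold re_part, Re; cbn; ring.
- eapply harmonic_jet_ext; [| | | exact (harmonic_jet_lin 1 1 _ _ _ _ _ _ Hv Hv')]; try reflexivity.
  intros x y; unfold im_part, Im; cbn; ring.
- apply injective_projections; cbn; field.
- apply injective_projections; cbn; field.
Qed.

(** A real function with gradient 2 zeta has Wirtinger derivatives conj zeta and zeta. *)
Lemma harmonic_with_arc (w zeta : C) :
  Cmod zeta = 1 ->
  harmonic_with (fun z => (w * arc_potential (Re zeta) (Im zeta) (Re z) (Im z))%C)
    (w * Cconj zeta)%C (w * zeta)%C.
Proof.
destruct zeta as [P Q]; destruct w as [r s]; intros H.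
assert (PQ : P ^ 2 + Q ^ 2 = 1).
{ apply (f_equal (fun t => t ^ 2)) in H; unfold Cmod in H.
  rewrite pow2_sqrt in H; cbn [fst snd] in H; nra. }
pose proof (arc_potential_jet P Q PQ) as J.
split.
{ cbn [Re Im fst snd RtoC].
  unfold arc_potential.
  replace (2 * (P * 0 + Q * 0) / (1 - 0 ^ 2 - 0 ^ 2)) with 0 by field.
  rewrite atan_0; ring. }
exists (r * (2 * P) + 0 * 0), (r * (2 * Q) + 0 * 0), (s * (2 * P) + 0 * 0), (s * (2 * Q) + 0 * 0).
split; [|split; [|split]].
- eapply harmonic_jet_ext; [| | | exact (harmonic_jet_lin r 0 _ _ _ _ _ _ J harmonic_jet_zero)];
    try reflexivity.
  intros x y; unfold re_part, Re; cbn; ring.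
- eapply harmonic_jet_ext; [| | | exact (harmonic_jet_lin s 0 _ _ _ _ _ _ J harmonic_jet_zero)];
    try reflexivity.
  intros x y; unfold im_part, Im; cbn; ring.
- apply injective_projections; cbn; field.
- apply injective_projections; cbn; field.
Qed.
(** * Step functions on a quarter of the circle *)

(* [p] and [q] are the sines and cosines of the end points of the [S n] arcs. *)
Definition quarter_arc (n : nat) (p q : nat -> R) : Prop :=
  p O = 0 /\ q O = 1 /\ p (S n) = 1 /\ q (S n) = 0 /\
  (forall j, 0 <= p j /\ 0 <= q j /\ p j ^ 2 + q j ^ 2 = 1) /\
  (forall j, (j <= n)%nat -> p j <= p (S j) /\ q (S j) <= q j).

Lemma sum_f_R0_telescope (u : nat -> R) (n : nat) :
  sum_f_R0 (fun j => u (S j) - u j) n = u (S n) - u O.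
Proof.
induction n as [|n IH]; [reflexivity|].
rewrite tech5, IH; ring.
Qed.

(** On the quarter circle x p + y q grows until (p, q) points along (x, y); the last hypothesis says
    that (p', q') has not passed that direction. *)
Lemma rising_step (x y p q p' q' : R) :
  0 <= x -> 0 <= y -> 0 <= p <= p' -> 0 <= q' <= q ->
  p ^ 2 + q ^ 2 = 1 -> p' ^ 2 + q' ^ 2 = 1 ->
  y * p' <= x * q' -> x * p + y * q <= x * p' + y * q'.
Proof.
intros Hx Hy Hp Hq E E' H.
destruct (Req_dec (q + q') 0) as [Z|Z].
{ assert (q = 0) by lra; assert (q' = 0) by lra; subst q q'.
  assert (p = 1) by nra; assert (p' = 1) by nra; subst; lra. }
(* On the circle the increments satisfy [(q - q') (q + q') = (p' - p) (p + p')]. *)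
assert (A : y * (p + p') <= x * (q + q')) by nra.
assert (B : (q - q') * (q + q') = (p' - p) * (p + p')) by nra.
assert (C : y * (q - q') * (q + q') <= x * (p' - p) * (q + q')) by nra.
assert (0 < q + q') by lra.
apply Rmult_le_reg_r in C; lra.
Qed.

Lemma atan_le (u v : R) : u <= v -> atan u <= atan v.
Proof.
intros [H| ->]; [left; now apply atan_increasing | apply Rle_refl].
Qed.

(* Along a quarter turn, [atan (K (x p + y q))] rises to [atan (K |(x, y)|)] and
   then falls, while [atan (K (x p - y q))] is monotone. *)
Lemma variation_quarter_arc (n : nat) (p q : nat -> R) (x y K : R) :
  quarter_arc n p q -> 0 <= K -> 0 <= x -> 0 <= y ->
  let a j := atan (K * (x * p j + y * q j)) in
  let b j := atan (K * (x * p j - y * q j)) in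
  sum_f_R0 (fun j => Rabs (a (S j) - a j) + Rabs (b (S j) - b j)) n
  <= 2 * atan (K * sqrt (x ^ 2 + y ^ 2)).
Proof.
intros (Hp0 & Hq0 & Hpn & Hqn & Hpq & Hmono) HK Hx Hy a b.
set (M := atan (K * sqrt (x ^ 2 + y ^ 2))).
assert (HaM : forall j, a j <= M).
{ intros j; apply atan_le, Rmult_le_compat_l; [assumption|].
  destruct (Hpq j) as (P & Q & E).
  rewrite <- (sqrt_pow2 (x * p j + y * q j)) by nra.
  apply sqrt_le_1_alt.
  assert (0 <= (x * q j - y * p j) ^ 2) by apply pow2_ge_0.
  assert (x ^ 2 + y ^ 2 = (x * p j + y * q j) ^ 2 + (x * q j - y * p j) ^ 2);
    [|lra].
  transitivity ((x ^ 2 + y ^ 2) * (p j ^ 2 + q j ^ 2)); [rewrite E; ring | ring]. }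
(* [V] continues [a] past its maximum by reflection in the level [M], so its increments dominate
   those of [a], also on the arc containing the maximum. *)
pose (V := fun j => if Rle_dec (y * p j) (x * q j) then a j else 2 * M - a j).
apply Rle_trans with (sum_f_R0 (fun j => (V (S j) + b (S j)) - (V j + b j)) n).
- apply sum_Rle; intros j Hj.
  destruct (Hpq j) as (P & Q & E), (Hpq (S j)) as (P' & Q' & E'), (Hmono j Hj) as (I & I').
  assert (Hb : b j <= b (S j)).
  { apply atan_le, Rmult_le_compat_l; [assumption|nra]. }
  pose proof (HaM j) as A; pose proof (HaM (S j)) as A'.
  rewrite (Rabs_pos_eq (b (S j) - b j)) by lra.
  enough (Rabs (a (S j) - a j) <= V (S j) - V j) by lra.
  apply Rabs_le; unfold V.
  destruct (Rle_dec (y * p j) (x * q j)) as [L|L],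
           (Rle_dec (y * p (S j)) (x * q (S j))) as [L'|L'].
  + assert (a j <= a (S j)); [|lra].
    apply atan_le, Rmult_le_compat_l; [assumption|].
    apply rising_step; lra.
  + lra.
  + exfalso; apply L.
    apply Rle_trans with (y * p (S j)); [now apply Rmult_le_compat_l|].
    apply Rle_trans with (1 := L'); now apply Rmult_le_compat_l.
  + assert (a (S j) <= a j); [|lra].
    apply atan_le, Rmult_le_compat_l; [assumption|].
    (* The fall is a rise traversed backwards with sine and cosine exchanged. *)
    pose proof (rising_step y x (q (S j)) (p (S j)) (q j) (p j)); lra.
- rewrite (sum_f_R0_telescope (fun j => V j + b j)).
  (* The initial terms cancel; at the end [b] agrees with [a], so the telescoped sum is [2 * M] or
     [2 * a (S n)]. *)
  assert (Hb0 : b O = - a O).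
  { unfold a, b; rewrite Hp0, Hq0, <- atan_opp; f_equal; ring. }
  assert (Hbn : b (S n) = a (S n)).
  { unfold a, b; rewrite Hpn, Hqn; f_equal; ring. }
  assert (HV0 : V O = a O).
  { unfold V; destruct Rle_dec as [L|L]; [reflexivity|].
    contradict L; rewrite Hp0, Hq0; lra. }
  rewrite HV0, Hb0, Hbn; unfold V.
  pose proof (HaM (S n)).
  destruct Rle_dec; lra.
Qed.

(** Changing the sign of x or y only exchanges [a] and [b], up to sign since atan is odd, which
    leaves the sum unchanged. *)
Lemma variation_quarter_arc_signed (n : nat) (p q : nat -> R) (x y K : R) :
  quarter_arc n p q -> 0 <= K ->
  let a j := atan (K * (x * p j + y * q j)) in
  let b j := atan (K * (x * p j - y * q j)) in
  sum_f_R0 (fun j => Rabs (a (S j) - a j) + Rabs (b (S j) - b j)) n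
  <= 2 * atan (K * sqrt (x ^ 2 + y ^ 2)).
Proof.
intros H HK a b.
pose proof (variation_quarter_arc n p q (Rabs x) (Rabs y) K H HK (Rabs_pos x) (Rabs_pos y)) as V.
cbv zeta in V; rewrite !pow2_abs in V.
refine (Rle_trans _ _ _ (Req_le _ _ _) V).
apply sum_eq; intros j _.
assert (odd : forall u v u' v', u = - u' -> v = - v' ->
  Rabs (atan (K * u) - atan (K * v)) = Rabs (atan (K * u') - atan (K * v'))).
{ intros u v u' v' -> ->.
  rewrite !Ropp_mult_distr_r_reverse, !atan_opp, <- Rabs_Ropp; f_equal; ring. }
unfold a, b.
destruct (Rcase_abs x) as [X|X];
  [rewrite (Rabs_left x X) | rewrite (Rabs_right x X)];
  (destruct (Rcase_abs y) as [Y|Y];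
   [rewrite (Rabs_left y Y) | rewrite (Rabs_right y Y)]).
- f_equal; apply odd; ring.
- rewrite Rplus_comm; f_equal; apply odd; ring.
- rewrite Rplus_comm; f_equal; do 2 f_equal; f_equal; ring.
- reflexivity.
Qed.

Lemma harmonic_with_sum (f : nat -> C -> C) (r r' : nat -> R) (k k' : C) (n : nat) :
  (forall j, harmonic_with (f j) (r j * k)%C (r' j * k')%C) ->
  harmonic_with (fun z => sum_n (fun j => f j z) n)
    (sum_f_R0 r n * k)%C (sum_f_R0 r' n * k')%C.
Proof.
intros H.
assert (ext : forall g h a b a' b', (forall z, g z = h z) -> a = a' -> b = b' ->
  harmonic_with g a b -> harmonic_with h a' b').
{ intros g h a b a' b' E <- <- (G0 & ux & uy & vx & vy & Hu & Hv & Ha & Hb).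
  split; [now rewrite <- E|].
  exists ux, uy, vx, vy; split; [|split; [|now split]].
  - eapply harmonic_jet_ext; [| | | exact Hu]; try reflexivity.
    intros x y; unfold re_part; now rewrite E.
  - eapply harmonic_jet_ext; [| | | exact Hv]; try reflexivity.
    intros x y; unfold im_part; now rewrite E. }
induction n as [|n IH].
- apply ext with (4 := H O); try reflexivity.
  intros z; now rewrite sum_O.
- apply ext with (4 := harmonic_with_plus _ _ _ _ _ _ IH (H (S n))).
  + intros z; now rewrite sum_Sn.
  + rewrite tech5, RtoC_plus; ring.
  + rewrite tech5, RtoC_plus; ring.
Qed.

Lemma Cmod_sum_n_le (u : nat -> C) (v : nat -> R) (n : nat) :
  (forall j, Cmod (u j) <= v j) -> Cmod (sum_n u n) <= sum_f_R0 v n.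
Proof.
intros H; induction n as [|n IH].
- rewrite sum_O; apply H.
- rewrite sum_Sn, tech5.
  apply Rle_trans with (1 := Cmod_triangle _ _), Rplus_le_compat; auto.
Qed.

(* Without the rotations [c] and [d], the boundary values are [x j + i y j] on the arc of
   the first quadrant where the sine lies between [p j] and [p (S j)]. *)
Lemma step_map (n : nat) (p q x y : nat -> R) (c d : C) :
  quarter_arc n p q -> (forall j, x j ^ 2 + y j ^ 2 <= 1) -> Cmod c = 1 -> Cmod d = 1 ->
  let s := sum_f_R0 (fun j => x j * (p (S j) - p j)) n in
  let t := sum_f_R0 (fun j => y j * (q j - q (S j))) n in
  exists f : C -> C,
    harmonic_with f (RtoC (2 / PI * (s + t)) * (c * d))%C
      (RtoC (2 / PI * (s - t)) * (c * Cconj d))%C /\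
    forall z, in_disc z -> in_disc (f z).
Proof.
intros Harc Hxy Hc Hd s t.
pose proof PI_RGT_0 as Hpi.
(* Without the rotations, the difference of the potentials of [zb (S j)] and [zb j] has boundary
   values PI on the j-th arc, - PI on the opposite arc and 0 elsewhere. Those of [za] do the same
   for the arc reflected in the real axis, whence the conjugate weight in [wa]. *)
pose (za := fun j => Cmult (p j, q j) (Cconj d)).
pose (zb := fun j => Cmult (p j, - q j) (Cconj d)).
pose (wa := fun j => Cmult c (x j / PI, - y j / PI)).
pose (wb := fun j => Cmult c (x j / PI, y j / PI)).
pose (arc := fun zeta z => RtoC (arc_potential (Re zeta) (Im zeta) (Re z) (Im z))).
pose (term := fun j z => (wa j * arc (za (S j)) z + - wa j * arc (za j) z +
   (wb j * arc (zb (S j)) z + - wb j * arc (zb j) z))%C).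
exists (fun z => sum_n (fun j => term j z) n).
assert (Hpq := proj1 (proj2 (proj2 (proj2 (proj2 Harc))))).
assert (Hza : forall j, Cmod (za j) = 1).
{ intros j; unfold za; rewrite Cmod_mult, Cmod_conj, Hd, Rmult_1_r.
  unfold Cmod; simpl fst; simpl snd.
  destruct (Hpq j) as (_ & _ & E); rewrite E; apply sqrt_1. }
assert (Hzb : forall j, Cmod (zb j) = 1).
{ intros j; unfold zb; rewrite Cmod_mult, Cmod_conj, Hd, Rmult_1_r.
  unfold Cmod; simpl fst; simpl snd.
  destruct (Hpq j) as (_ & _ & E).
  replace (p j ^ 2 + (- q j) ^ 2) with 1 by (rewrite <- E; ring); apply sqrt_1. }
split.
- assert (E : forall e, 2 / PI * (s + e * t) = sum_f_R0 (fun j =>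
    2 / PI * (x j * (p (S j) - p j) + e * (y j * (q j - q (S j))))) n).
  { intros e; unfold s, t; rewrite scal_sum, <- sum_plus, scal_sum.
    apply sum_eq; intros; ring. }
  replace (s + t) with (s + 1 * t) by ring.
  replace (s - t) with (s + -1 * t) by ring.
  rewrite !E.
  apply harmonic_with_sum; intros j.
  assert (H : harmonic_with (term j)
    (wa j * Cconj (za (S j)) + - wa j * Cconj (za j) +
      (wb j * Cconj (zb (S j)) + - wb j * Cconj (zb j)))%C
    (wa j * za (S j) + - wa j * za j + (wb j * zb (S j) + - wb j * zb j))%C).
  { repeat apply harmonic_with_plus; now apply harmonic_with_arc. }
  match goal with |- harmonic_with _ ?a ?b =>
    match type of H with harmonic_with _ ?a' ?b' =>
      replace a with a'; [replace b with b'|] end end; [exact H| |];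
    destruct c as [c1 c2], d as [d1 d2]; unfold wa, wb, za, zb;
    apply injective_projections; cbn; field; lra.
- intros z Hz.
  assert (Hz2 : Re z ^ 2 + Im z ^ 2 < 1) by (destruct z; now apply in_disc_sqr).
  (* Rotating zeta by conj d amounts to rotating z by d, which brings the potentials into the form
     of the variation bound. *)
  pose (v := (d * z)%C).
  pose (K := 2 / (1 - Re z ^ 2 - Im z ^ 2)).
  assert (HK : 0 <= K).
  { apply Rlt_le, Rdiv_lt_0_compat; lra. }
  assert (Ha : forall j, arc (za j) z = atan (K * (Re v * p j + Im v * q j))).
  { intros j; unfold arc, arc_potential; do 2 f_equal.
    unfold za, v, K; destruct z as [z1 z2], d as [d1 d2]; cbn in *; field; lra. }
  assert (Hb : forall j, arc (zb j) z = atan (K * (Re v * p j - Im v * q j))).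
  { intros j; unfold arc, arc_potential; do 2 f_equal.
    unfold zb, v, K; destruct z as [z1 z2], d as [d1 d2]; cbn in *; field; lra. }
  pose proof (variation_quarter_arc_signed n p q (Re v) (Im v) K Harc HK) as V.
  cbv zeta in V.
  assert (Hu : forall a b e : R, e = b \/ e = - b -> a ^ 2 + b ^ 2 <= 1 ->
    Cmod (Cmult c (a / PI, e / PI)) <= 1 / PI).
  { intros a b e He Hab; rewrite Cmod_mult, Hc, Rmult_1_l.
    unfold Cmod; simpl fst; simpl snd.
    rewrite <- (sqrt_pow2 (1 / PI)) by (apply Rlt_le, Rdiv_lt_0_compat; lra).
    apply sqrt_le_1_alt.
    replace ((a / PI) ^ 2 + (e / PI) ^ 2) with ((a ^ 2 + b ^ 2) * (1 / PI) ^ 2)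
      by (destruct He as [-> | ->]; field; lra).
    rewrite <- (Rmult_1_l ((1 / PI) ^ 2)) at 2.
    apply Rmult_le_compat_r; [apply pow2_ge_0 | assumption]. }
  unfold in_disc.
  (* Each weight has modulus at most 1 / PI, so the variation bounds the sum; strictness comes from
     atan < PI / 2. *)
  apply Rle_lt_trans with (1 / PI * (2 * atan (K * sqrt (Re v ^ 2 + Im v ^ 2)))).
  + apply Rle_trans with (2 := Rmult_le_compat_l (1 / PI) _ _
      (Rlt_le _ _ (Rdiv_lt_0_compat _ _ Rlt_0_1 Hpi)) V).
    rewrite scal_sum.
    apply Cmod_sum_n_le; intros j.
    unfold term; rewrite !Ha, !Hb.
    match goal with |- Cmod (_ * RtoC ?a' + - _ * RtoC ?a + (_ * RtoC ?b' + - _ * RtoC ?b))%C <= _ =>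
      replace (wa j * RtoC a' + - wa j * RtoC a + (wb j * RtoC b' + - wb j * RtoC b))%C
        with (wa j * RtoC (a' - a) + wb j * RtoC (b' - b))%C
        by (rewrite !RtoC_minus; ring) end.
    apply Rle_trans with (1 := Cmod_triangle _ _).
    rewrite !Cmod_mult, !Cmod_R, Rmult_plus_distr_r, !(Rmult_comm (Rabs _)).
    apply Rplus_le_compat; apply Rmult_le_compat_r; try apply Rabs_pos.
    * apply (Hu (x j) (y j) (- y j)); auto.
    * apply (Hu (x j) (y j) (y j)); auto.
  + apply Rlt_le_trans with (1 / PI * (2 * (PI / 2))).
    * apply Rmult_lt_compat_l; [apply Rdiv_lt_0_compat; lra|].
      apply Rmult_lt_compat_l; [lra | apply atan_bound].
    * apply Req_le; field; lra.
Qed.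

(** * The finite-dimensional problem *)

(** Pythagorean triples give rational points of the circle; the defaults 1 and 0 supply the last end
    point, at j = 7. *)
Definition sines (j : nat) : R :=
  nth j [0; 16 / 65; 8 / 17; 20 / 29; 4 / 5; 12 / 13; 60 / 61] 1.
Definition cosines (j : nat) : R :=
  nth j [1; 63 / 65; 15 / 17; 21 / 29; 3 / 5; 5 / 13; 11 / 61] 0.

Lemma quarter_arc_sines : quarter_arc 6 sines cosines.
Proof.
unfold sines, cosines.
split; [reflexivity|split; [reflexivity|split; [reflexivity|split; [reflexivity|split]]]].
- intros j; do 7 (destruct j as [|j]; [simpl; lra|]); destruct j; simpl; lra.
- intros j Hj; do 7 (destruct j as [|j]; [simpl; lra|]); lia.
Qed.

Definition reachable (s t : R) : Prop :=
  exists x y : nat -> R,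
    (forall j, x j ^ 2 + y j ^ 2 <= 1) /\
    s = sum_f_R0 (fun j => x j * (sines (S j) - sines j)) 6 /\
    t = sum_f_R0 (fun j => y j * (cosines j - cosines (S j))) 6.

(** Multiplying all [x j] by l and all [y j] by m with |l|, |m| <= 1 keeps the step values in the
    closed disc. *)
Lemma reachable_smaller (s t s' t' : R) :
  reachable s t -> Rabs s' <= s -> Rabs t' <= t -> reachable s' t'.
Proof.
intros (x & y & H & Hs & Ht) Hs' Ht'.
assert (E : forall a b, Rabs a <= b -> exists l, l ^ 2 <= 1 /\ a = l * b).
{ intros a b Hab.
  destruct (Req_dec b 0) as [->|Hb].
  - exists 0; split; [lra|].
    destruct (Req_dec a 0) as [->|Ha]; [ring | pose proof (Rabs_pos_lt a Ha); lra].
  - exists (a / b); split; [|now field].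
    pose proof (Rabs_pos a).
    assert (Hb2 : 0 < b ^ 2) by (apply pow_lt; lra).
    replace ((a / b) ^ 2) with (Rabs a ^ 2 / b ^ 2)
      by (rewrite pow2_abs; field; assumption).
    apply Rmult_le_reg_r with (b ^ 2); [assumption|].
    replace (Rabs a ^ 2 / b ^ 2 * b ^ 2) with (Rabs a ^ 2) by (field; assumption).
    nra. }
destruct (E _ _ Hs') as (l & Hl & ->), (E _ _ Ht') as (m & Hm & ->).
exists (fun j => l * x j), (fun j => m * y j); split; [|split].
- intros j; specialize (H j); rewrite !Rpow_mult_distr.
  pose proof (pow2_ge_0 (x j)); pose proof (pow2_ge_0 (y j)); nra.
- rewrite Hs, scal_sum; apply sum_eq; intros; ring.
- rewrite Ht, scal_sum; apply sum_eq; intros; ring.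
Qed.

(** Convexity of the disc makes the chord reachable, and the point lies at or to the left of it. *)
Lemma reachable_chord (s1 t1 s2 t2 s t : R) :
  reachable s1 t1 -> reachable s2 t2 -> t1 < t2 -> t1 <= t <= t2 -> 0 <= s -> 0 <= t ->
  s * (t2 - t1) <= s1 * (t2 - t) + s2 * (t - t1) -> reachable s t.
Proof.
intros (x & y & H & Hs & Ht) (x' & y' & H' & Hs' & Ht') H12 Htt Hs0 Ht0 Hc.
pose (l := (t - t1) / (t2 - t1)).
assert (Hl : l * (t2 - t1) = t - t1) by (unfold l; field; lra).
assert (0 <= l) by nra.
assert (l <= 1) by nra.
apply reachable_smaller with ((1 - l) * s1 + l * s2) t.
- exists (fun j => (1 - l) * x j + l * x' j), (fun j => (1 - l) * y j + l * y' j).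
  split; [|split].
  + intros j; specialize (H j); specialize (H' j).
    pose proof (pow2_ge_0 (x j - x' j)); pose proof (pow2_ge_0 (y j - y' j)).
    assert (0 <= l * (1 - l) * ((x j - x' j) ^ 2 + (y j - y' j) ^ 2)).
    { apply Rmult_le_pos; nra. }
    nra.
  + rewrite Hs, Hs', !scal_sum, <- sum_plus; apply sum_eq; intros; ring.
  + replace t with ((1 - l) * t1 + l * t2) by lra.
    rewrite Ht, Ht', !scal_sum, <- sum_plus; apply sum_eq; intros; ring.
- rewrite Rabs_pos_eq by assumption.
  apply Rmult_le_reg_r with (t2 - t1); nra.
- rewrite Rabs_pos_eq by assumption; lra.
Qed.

(* [k j / 100] is the tangent of half the argument of the [j]-th step value. *)
Lemma reachable_grid (slopes : list Z) (s t : R) :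
  let k j := nth j slopes 0%Z in
  let x j := IZR (10000 - k j * k j) / IZR (10000 + k j * k j) in
  let y j := IZR (200 * k j) / IZR (10000 + k j * k j) in
  0 <= s <= sum_f_R0 (fun j => x j * (sines (S j) - sines j)) 6 ->
  0 <= t <= sum_f_R0 (fun j => y j * (cosines j - cosines (S j))) 6 ->
  reachable s t.
Proof.
intros k x y Hs Ht.
eapply reachable_smaller.
- exists x, y.
  split; [|split; reflexivity].
  intros j; apply Req_le; unfold x, y.
  rewrite minus_IZR, plus_IZR, !mult_IZR.
  field; pose proof (Rle_0_sqr (IZR (k j))); unfold Rsqr in *; lra.
- rewrite Rabs_pos_eq; lra.
- rewrite Rabs_pos_eq; lra.
Qed.

(** First-order convexity inequality for the gauge 3 s^4 + 2 s^2 t^2 + 3 t^4 at (s0, t0), which may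
    lie slightly off the boundary curve; [A], [B] and [D] add up to the remainder. *)
Lemma tangent_bound (s t s0 t0 : R) :
  3 * s ^ 4 + 2 * s ^ 2 * t ^ 2 + 3 * t ^ 4 <= 3 -> 0 <= s0 -> 0 <= t0 ->
  (12 * s0 ^ 3 + 4 * s0 * t0 ^ 2) * (s - s0) + (12 * t0 ^ 3 + 4 * s0 ^ 2 * t0) * (t - t0)
  <= 3 - (3 * s0 ^ 4 + 2 * s0 ^ 2 * t0 ^ 2 + 3 * t0 ^ 4).
Proof.
intros H Hs Ht.
assert (A : 0 <= (6 * s0 ^ 2 + 2 * t0 ^ 2) * (s - s0) ^ 2).
{ apply Rmult_le_pos; [nra | apply pow2_ge_0]. }
assert (B : 0 <= (2 * s0 ^ 2 + 6 * t0 ^ 2) * (t - t0) ^ 2).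
{ apply Rmult_le_pos; [nra | apply pow2_ge_0]. }
(* The gauge is a positive definite quadratic form in [(s ^ 2, t ^ 2)]. *)
assert (D : 0 <= 2 * (s ^ 2 - s0 ^ 2) ^ 2 + 2 * (t ^ 2 - t0 ^ 2) ^ 2
                 + (s ^ 2 - s0 ^ 2 + (t ^ 2 - t0 ^ 2)) ^ 2).
{ repeat apply Rplus_le_le_0_compat; try (apply Rmult_le_pos; [lra|]); apply pow2_ge_0. }
lra.
Qed.

(* Near [(1, 0)] the region is [1 - s >= t ^ 2 / 6] to leading order, and steps of
   slopes proportional to [w] do better: [1 - s] is about [0.1637 t ^ 2]. *)
Lemma near_corner (s t : R) :
  0 <= s -> 0 <= t <= 0.25 ->
  3 * s ^ 4 + 2 * s ^ 2 * t ^ 2 + 3 * t ^ 4 <= 3 -> reachable s t.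
Proof.
intros Hs Ht H.
(* [w j] is the optimal ratio (q_j - q_(j+1)) / (p_(j+1) - p_j), except that the last one is cut
   from 11 to 6 to keep [w j * tau] below 0.62. The factor in [tau] makes the second sum equal to
   t. *)
pose (w := fun j => nth j [1 / 8; 12 / 31; 13 / 18; 9 / 8; 7 / 4; 27 / 8; 6] 0).
pose (tau := 22692 / 55363 * t).
assert (Htau : 0 <= tau <= 0.1025) by (unfold tau; lra).
assert (Hw : forall j, 0 <= w j <= 6).
{ intros j; unfold w; do 7 (destruct j as [|j]; [simpl; lra|]); destruct j; simpl; lra. }
pose (r := fun j => (w j * tau) ^ 2).
apply reachable_smaller with
  (sum_f_R0 (fun j => (1 - r j / 2 - r j ^ 2 / 6) * (sines (S j) - sines j)) 6) t.
(* The first coordinate is a polynomial lower bound for sqrt (1 - r), valid for r <= 0.4. *)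
- exists (fun j => 1 - r j / 2 - r j ^ 2 / 6), (fun j => w j * tau).
  split; [|split; [reflexivity|]].
  + intros j; fold (r j).
    assert (Hr : 0 <= r j <= 0.4).
    { specialize (Hw j); unfold r; split; [apply pow2_ge_0|].
      assert (0 <= w j * tau <= 0.62) by (split; nra); nra. }
    revert Hr; generalize (r j); intros a Ha.
    replace ((1 - a / 2 - a ^ 2 / 6) ^ 2 + a)
      with (1 - a ^ 2 * (1 / 12 - a / 6 - a ^ 2 / 36)) by field.
    assert (0 <= a ^ 2 * (1 / 12 - a / 6 - a ^ 2 / 36)); [|lra].
    apply Rmult_le_pos; [apply pow2_ge_0 | nra].
  + unfold cosines, w, tau; simpl; field.
- rewrite Rabs_pos_eq by assumption.
  assert (E : 1 - 0.16363 * t ^ 2 - 0.14345 * t ^ 4 <=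
    sum_f_R0 (fun j => (1 - r j / 2 - r j ^ 2 / 6) * (sines (S j) - sines j)) 6).
  { unfold sines, r, w, tau; simpl.
    assert (0 <= t ^ 2) by apply pow2_ge_0.
    assert (0 <= t ^ 4) by (apply pow_le; lra).
    lra. }
  apply Rle_trans with (2 := E).
  apply Rnot_lt_le; intros C.
  set (v := t ^ 2) in *.
  replace (t ^ 4) with (v ^ 2) in * by (unfold v; ring).
  assert (Hv : 0 <= v <= 0.0625) by (unfold v; split; nra).
  set (e := 0.16363 * v + 0.14345 * v ^ 2).
  assert (He : 0 <= e <= 0.1) by (unfold e; split; nra).
  assert (S2 : 1 - 2 * e < s ^ 2) by (unfold e in *; nra).
  assert (S4 : (1 - 2 * e) ^ 2 < s ^ 4).
  { replace (s ^ 4) with (s ^ 2 * s ^ 2) by ring; nra. }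
  (* This is the gauge minus 3 after inserting the lower bounds for s^2 and s^4 and dropping 12 e^2;
     its sign contradicts the hypothesis. *)
  assert (P : 0 <= v * (0.03644 + 0.62408 * v - 0.5738 * v ^ 2)).
  { apply Rmult_le_pos; nra. }
  assert (0 <= e ^ 2) by apply pow2_ge_0.
  assert (v * (1 - 2 * e) <= v * s ^ 2) by (apply Rmult_le_compat_l; lra).
  unfold e in *; lra.
- rewrite Rabs_pos_eq; lra.
Qed.

Lemma region_reachable (s t : R) :
  0 <= t <= s -> 3 * s ^ 4 + 2 * s ^ 2 * t ^ 2 + 3 * t ^ 4 <= 3 -> reachable s t.
Proof.
intros Hts H.
(* The step values roughly follow the directions (p_(j+1) - p_j, lambda (q_j - q_(j+1))), which are
   optimal for a linear functional; lambda grows from vertex to vertex. *)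
assert (P0 : reachable 0.9898 0.2467).
{ apply (reachable_grid [1; 2; 3; 5; 8; 15; 41]%Z); unfold sines, cosines; simpl; lra. }
assert (P1 : reachable 0.9798 0.3338).
{ apply (reachable_grid [1; 3; 5; 8; 12; 23; 55]%Z); unfold sines, cosines; simpl; lra. }
assert (P2 : reachable 0.9612 0.4356).
{ apply (reachable_grid [1; 4; 8; 13; 19; 34; 68]%Z); unfold sines, cosines; simpl; lra. }
assert (P3 : reachable 0.9324 0.5376).
{ apply (reachable_grid [2; 7; 12; 19; 28; 46; 77]%Z); unfold sines, cosines; simpl; lra. }
assert (P4 : reachable 0.9001 0.6167).
{ apply (reachable_grid [3; 9; 17; 25; 36; 56; 83]%Z); unfold sines, cosines; simpl; lra. }
assert (P5 : reachable 0.8628 0.6843).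
{ apply (reachable_grid [4; 12; 22; 32; 44; 64; 87]%Z); unfold sines, cosines; simpl; lra. }
assert (P6 : reachable 0.8232 0.7396).
{ apply (reachable_grid [5; 15; 27; 39; 52; 70; 89]%Z); unfold sines, cosines; simpl; lra. }
assert (P7 : reachable 0.7788 0.7883).
{ apply (reachable_grid [6; 19; 33; 46; 59; 75; 92]%Z); unfold sines, cosines; simpl; lra. }
destruct (Rle_dec t 0.25) as [T0|T0]; [apply near_corner; lra|].
destruct (Rle_dec t 0.3338) as [T1|T1].
{ apply (reachable_chord _ _ _ _ _ _ P0 P1); try lra.
  pose proof (tangent_bound s t 0.9854 0.2804); lra. }
destruct (Rle_dec t 0.4356) as [T2|T2].
{ apply (reachable_chord _ _ _ _ _ _ P1 P2); try lra.
  pose proof (tangent_bound s t 0.9705 0.3819); lra. }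
destruct (Rle_dec t 0.5376) as [T3|T3].
{ apply (reachable_chord _ _ _ _ _ _ P2 P3); try lra.
  pose proof (tangent_bound s t 0.9465 0.4866); lra. }
destruct (Rle_dec t 0.6167) as [T4|T4].
{ apply (reachable_chord _ _ _ _ _ _ P3 P4); try lra.
  pose proof (tangent_bound s t 0.9152 0.5782); lra. }
destruct (Rle_dec t 0.6843) as [T5|T5].
{ apply (reachable_chord _ _ _ _ _ _ P4 P5); try lra.
  pose proof (tangent_bound s t 0.8802 0.6517); lra. }
destruct (Rle_dec t 0.7396) as [T6|T6].
{ apply (reachable_chord _ _ _ _ _ _ P5 P6); try lra.
  pose proof (tangent_bound s t 0.8421 0.7122); lra. }
(* The curve meets the diagonal near 0.7825; the tangent there bounds s + t, hence t, since t <=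
   s. *)
assert (T7 : t <= 0.7883) by (pose proof (tangent_bound s t 0.7825 0.7825); lra).
apply (reachable_chord _ _ _ _ _ _ P6 P7); try lra.
pose proof (tangent_bound s t 0.8002 0.7640); lra.
Qed.

(** * Rotations and the theorem *)

Lemma C_polar (z : C) : exists u : C, Cmod u = 1 /\ z = (Cmod z * u)%C.
Proof.
destruct (Ceq_dec z 0%C) as [->|Hz].
- exists 1%C; rewrite Cmod_0, Cmod_1; split; [reflexivity | ring].
- pose proof (Cmod_gt_0 z) as [P _]; specialize (P Hz).
  assert (N : RtoC (Cmod z) <> 0%C) by (intros E; apply RtoC_inj in E; lra).
  exists (z / Cmod z)%C; split; [|now field].
  rewrite Cmod_div by assumption.
  rewrite Cmod_R, Rabs_pos_eq by lra; field; lra.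
Qed.

Lemma C_unit_sqrt (u : C) : Cmod u = 1 -> exists c : C, Cmod c = 1 /\ (c * c)%C = u.
Proof.
intros Hu.
destruct (Ceq_dec u (-1)%C) as [->|Hne].
{ exists Ci; split.
  - unfold Ci, Cmod; simpl; replace (0 * _ + _) with 1 by ring; apply sqrt_1.
  - apply injective_projections; cbn; ring. }
(* Normalize [1 + u], which bisects the angle between [1] and [u]. *)
destruct (C_polar (1 + u)%C) as (c & Hc & E).
exists c; split; [assumption|].
assert (Hu2 : (u * Cconj u)%C = 1%C).
{ rewrite <- Cmod2_conj, Hu; f_equal; ring. }
assert (Hc2 : (c * Cconj c)%C = 1%C).
{ rewrite <- Cmod2_conj, Hc; f_equal; ring. }
assert (N : (1 + u)%C <> 0%C).
{ intros Z; apply Hne; replace u with ((1 + u) - 1)%C by ring; rewrite Z; ring. }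
(* Since |u| = 1, conj (1 + u) u = 1 + u; cancelling the modulus gives conj c u = c, hence u =
   c^2. *)
assert (M : (Cmod (1 + u) * (Cconj c * u))%C = (Cmod (1 + u) * c)%C).
{ rewrite <- E.
  transitivity (Cconj (Cmod (1 + u) * c) * u)%C.
  { rewrite Cmult_conj.
    replace (Cconj (Cmod (1 + u))) with (RtoC (Cmod (1 + u)))
      by (apply injective_projections; simpl; ring).
    ring. }
  rewrite <- E, Cplus_conj.
  replace (Cconj 1) with (RtoC 1) by (apply injective_projections; simpl; ring).
  rewrite Cmult_plus_distr_r, (Cmult_comm (Cconj u)), Hu2; ring. }
assert (P : RtoC (Cmod (1 + u)) <> 0%C).
{ pose proof (proj1 (Cmod_gt_0 _) N); intros Z; apply RtoC_inj in Z; lra. }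
assert (F : (Cconj c * u)%C = c).
{ transitivity (/ Cmod (1 + u) * (Cmod (1 + u) * (Cconj c * u)))%C; [now field|].
  rewrite M; now field. }
rewrite <- F at 2.
rewrite Cmult_assoc, Hc2; ring.
Qed.

Theorem theorem2 (alpha beta : C)
  (hab : fourth_root ((Cmod alpha ^ 4 + 4 * Cmod (alpha * beta)%C ^ 2
                       + Cmod beta ^ 4) / 6) <= 2 / PI) :
  exists f : C -> C,
    harmonic_on in_disc f /\
    (forall z : C, in_disc z -> in_disc (f z)) /\
    f 0%C = 0%C /\
    wirtinger f 0%C = alpha /\
    wirtinger_bar f 0%C = beta.
Proof.
pose proof PI_RGT_0 as Hpi.
pose proof (Cmod_ge_0 alpha) as HA; pose proof (Cmod_ge_0 beta) as HB.
pose (s := PI / 4 * (Cmod alpha + Cmod beta)).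
pose (t := PI / 4 * (Cmod alpha - Cmod beta)).
assert (Hst : Rabs t <= s).
{ unfold s, t; rewrite Rabs_mult, (Rabs_pos_eq (PI / 4)) by lra.
  apply Rmult_le_compat_l; [lra|]; apply Rabs_le; lra. }
assert (G : 3 * s ^ 4 + 2 * s ^ 2 * Rabs t ^ 2 + 3 * Rabs t ^ 4 <= 3).
{ rewrite Cmod_mult in hab.
  set (X := Cmod alpha ^ 4 + _ + _) in hab.
  assert (HX : X / 6 <= (2 / PI) ^ 4).
  { assert (0 <= X / 6).
    { unfold X; pose proof (pow_le _ 4 HA); pose proof (pow_le _ 4 HB).
      pose proof (pow2_ge_0 (Cmod alpha * Cmod beta)); lra. }
    unfold fourth_root in hab.
    rewrite <- (sqrt_sqrt (X / 6)) by assumption.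
    rewrite <- (sqrt_sqrt (sqrt (X / 6))) by apply sqrt_pos.
    replace (_ * _ * _) with (sqrt (sqrt (X / 6)) ^ 4) by ring.
    apply pow_incr; split; [apply sqrt_pos | assumption]. }
  replace (Rabs t ^ 4) with ((Rabs t ^ 2) ^ 2) by ring; rewrite pow2_abs.
  (* The change of variables turns the quartic form of the hypothesis into the gauge. *)
  replace (3 * s ^ 4 + 2 * s ^ 2 * t ^ 2 + 3 * (t ^ 2) ^ 2) with (3 * ((PI / 2) ^ 4 * (X / 6)))
    by (unfold s, t, X; field).
  replace 3 with (3 * ((PI / 2) ^ 4 * (2 / PI) ^ 4)) at 2 by (field; lra).
  apply Rmult_le_compat_l; [lra|].
  apply Rmult_le_compat_l; [apply pow_le; lra | assumption]. }
assert (R : reachable s t).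
{ apply reachable_smaller with s (Rabs t); try lra.
  - apply region_reachable; [split; [apply Rabs_pos | assumption] | assumption].
  - rewrite Rabs_pos_eq; [lra|]; apply Rle_trans with (2 := Hst), Rabs_pos. }
destruct R as (x & y & Hxy & Es & Et).
destruct (C_polar alpha) as (a & Ha & Ea), (C_polar beta) as (b & Hb & Eb).
(* The rotations must satisfy c d = a and c conj d = b, which forces c^2 = a b and d = conj c a. *)
destruct (C_unit_sqrt (a * b)%C) as (c & Hc & Ec).
{ rewrite Cmod_mult, Ha, Hb; ring. }
assert (Ha2 : (a * Cconj a)%C = 1%C).
{ rewrite <- Cmod2_conj, Ha; f_equal; ring. }
assert (Hc2 : (c * Cconj c)%C = 1%C).
{ rewrite <- Cmod2_conj, Hc; f_equal; ring. }
destruct (step_map 6 sines cosines x y c (Cconj c * a)%C) as (f & Hf & Hmap);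
  [apply quarter_arc_sines | assumption | assumption | |].
{ rewrite Cmod_mult, Cmod_conj, Hc, Ha; ring. }
rewrite <- Es, <- Et in Hf.
apply harmonic_with_correct in Hf; destruct Hf as (F1 & F2 & F3 & F4).
exists f; split; [assumption|split; [assumption|split; [assumption|split]]].
- rewrite F3.
  replace (c * (Cconj c * a))%C with a
    by (transitivity ((c * Cconj c) * a)%C; [rewrite Hc2|]; ring).
  replace (2 / PI * (s + t)) with (Cmod alpha) by (unfold s, t; field; lra).
  now symmetry.
- rewrite F4, Cmult_conj, Cconj_conj.
  replace (c * (c * Cconj a))%C with b
    by (transitivity (c * c * Cconj a)%C; [rewrite Ec|ring];
        transitivity (a * Cconj a * b)%C; [rewrite Ha2|]; ring).
  replace (2 / PI * (s - t)) with (Cmod beta) by (unfold s, t; field; lra).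
  now symmetry.
Qed.
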